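(* Let $A:X\to Y$, the ground truth $U$ with variance coefficients $\Pi_n$, the noise $\nu=\nu_\delta$ of level $\delta>0$ with variance coefficients $\Delta_n=\Delta_n(\delta)$, and $\overline g_n=\frac{\sigma_n\Pi_n}{\sigma_n^2\Pi_n+\Delta_n}$ be as specified in the context. Define the expected smoothness coefficients of the reconstructions by $$\tilde\Pi_n:=\mathbb E_{U,\nu}\big(\langle R(AU+\nu_\delta;\overline g),u_n\rangle^2\big).$$ Then for all $n$ $$\tilde\Pi_n=\frac{\sigma_n^2\Pi_n}{\sigma_n^2\Pi_n+\Delta_n}\,\Pi_n .$$ If, in addition, there exist $c>0$ and $n_0\in\mathbb N$ such that $\Delta_n(\delta)\ge c\,\delta^2\,\Pi_n$ for every $n\ge n_0$ and every $\delta>0$, then for every $n\ge n_0$ $$\tilde\Pi_n\le\frac{1}{1+\frac{c\,\delta^2}{\sigma_n^2}}\,\Pi_n .$$ In particular, for fixed $\delta>0$, $\tilde\Pi_n/\Pi_n$ (over those $n$ with $\Pi_n>0$) converges to zero at least as fast as $\sigma_n^2$, i.e. $\tilde\Pi_n/\Pi_n=O(\sigma_n^2)$.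
   Context: $X$ and $Y$ are infinite-dimensional real Hilbert spaces, and $A:X\to Y$ is a compact linear operator with infinite-dimensional range and singular value expansion $Au=\sum_{n=1}^\infty\sigma_n\langle u,u_n\rangle v_n$. Here $\sigma_n>0$ are the singular values, assumed strictly decreasing (each of multiplicity one), $\{u_n\}$ is an orthonormal basis of $\mathcal N(A)^\perp$ and $\{v_n\}$ is an orthonormal basis of $\overline{\mathcal R(A)}$. The ground truth $U$ is an $X$-valued random variable with $\mathbb E(\|U\|^2)<\infty$ and $\Pi_n:=\mathbb E(\langle U,u_n\rangle^2)$. For each noise level $\delta>0$ the noise $\nu_\delta$ is independent of $U$ and has zero mean; it enters only through its coefficients $\langle\nu_\delta,v_n\rangle$, which are real random variables with mean zero and second moment $\Delta_n(\delta):=\mathbb E(\langle\nu_\delta,v_n\rangle^2)$, and $\delta^2=\sup_n\Delta_n(\delta)$. (White noise is allowed, so $\nu_\delta$ need not take values in $Y$.) It is assumed throughout that for every $n$ (and every $\delta>0$) $\Pi_n>0$ or $\Delta_n(\delta)>0$. For a real sequence $g=(g_n)$, $R(f;g)=\sum_{n=1}^\infty g_n\langle f,v_n\rangle u_n$, so that $\langle R(AU+\nu_\delta;g),u_n\rangle=g_n(\sigma_n\langle U,u_n\rangle+\langle\nu_\delta,v_n\rangle)$. *)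

(* Defs.v *)
From HB Require Import structures.
From mathcomp Require Import all_boot all_order all_algebra.
From mathcomp Require Import sesquilinear.
From mathcomp Require Import all_classical all_reals all_analysis.

Set Implicit Arguments.
Unset Strict Implicit.
Unset Printing Implicit Defensive.

Import Order.TTheory GRing.Theory Num.Theory.
Import numFieldNormedType.Exports.

Local Open Scope classical_set_scope.
Local Open Scope ring_scope.

(* All sequences are indexed from 0: index n here is index n + 1 in a
   mathematical text that starts counting at 1. *)

(* Over a real field, {dot V for idfun} is the type of symmetric bilinear
   positive definite forms. *)
HB.mixin Record NormedModule_isHilbert (R : realType) V
    of CompleteNormedModule R V := {
  inner : {dot V for (idfun : R -> R)} ;
  norm_inner : forall x : V, `|x| = Num.sqrt (inner x x)
}.

#[short(type="hilbertType")]
HB.structure Definition Hilbert (R : realType) :=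
  {V of CompleteNormedModule R V & NormedModule_isHilbert R V}.

Section hilbert.
Context {R : realType}.

(* Meant for linear subspaces S. *)
Definition finite_dim (V : lmodType R) (S : set V) :=
  exists (n : nat) (e : 'I_n -> V),
    forall x, S x -> exists a : 'I_n -> R, x = \sum_(i < n) a i *: e i.

Definition orthocompl (V : hilbertType R) (S : set V) : set V :=
  [set x | forall z, S z -> inner x z = 0].

Definition seq_span (V : lmodType R) (e : nat -> V) : set V :=
  [set x | exists (n : nat) (a : nat -> R), x = \sum_(i < n) a i *: e i].

(* e is an orthonormal basis of the closed subspace S. *)
Definition orthonormal_basis (V : hilbertType R) (S : set V) (e : nat -> V) :=
  (forall i j, inner (e i) (e j) = (i == j)%:R) /\ closure (seq_span e) = S.

Definition compact_operator (V W : normedModType R) (A : V -> W) :=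
  forall B : set V, bounded_set B -> precompact (A @` B).

Definition kernel_set (V W : lmodType R) (A : V -> W) : set V :=
  [set x | A x = 0].

(* A x = \sum_n sigma n <x, u n> v n, with simple singular values. *)
Definition singular_value_expansion (X Y : hilbertType R) (A : X -> Y)
    (sigma : nat -> R) (u : nat -> X) (v : nat -> Y) :=
  [/\ forall n, 0 < sigma n,
      decreasing_seq sigma,
      orthonormal_basis (orthocompl (kernel_set A)) u,
      orthonormal_basis (closure (range A)) v &
      forall x, series (fun n => (sigma n * inner x (u n)) *: v n) @ \oo --> A x].

(* The spectral reconstruction \sum_n g n <f, v n> u n. The data f enter through
   the sequence fc n = <f, v n>, so that f need not be an element of a Hilbert
   space. *)
Definition reconstruction (X : hilbertType R) (u : nat -> X) (g fc : nat -> R) :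
    X :=
  limn (series (fun n => (g n * fc n) *: u n)).

Definition optimal_filter (sigma Pi Delta : nat -> R) (n : nat) : R :=
  sigma n * Pi n / (sigma n ^+ 2 * Pi n + Delta n).

End hilbert.

Definition borel (T : ptopologicalType) := g_sigma_algebraType (@open T).

Section probability_model.
Context {d : measure_display} {Omega : measurableType d} {R : realType}.
Variable P : probability Omega R.

Definition independent_systems (F G : set_system Omega) :=
  forall E1 E2, F E1 -> G E2 -> P (E1 `&` E2) = (P E1 * P E2)%E.

(* The random variable U is independent of the whole sequence xi, and not only
   of each of its terms. *)
Definition independent_of_seq {d'} {T : measurableType d'}
    (U : {RV P >-> T}) (xi : nat -> {RV P >-> R}) :=
  independent_systems (g_sigma_algebra_preimage U)
    <<s \bigcup_n g_sigma_algebra_preimage (xi n) >>.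

Variables (X Y : hilbertType R) (A : X -> Y) (u : nat -> X) (v : nat -> Y).
Variable U : {RV P >-> borel X}.

Definition signal_coef (n : nat) : R := fine 'E_P[fun w => inner (U w : X) (u n) ^+ 2].

(* xi n stands for the coefficient <nu, v n> of a noise nu that may fail to be
   Y-valued, as in the case of white noise. *)
Definition noise_coef (xi : nat -> {RV P >-> R}) (n : nat) : R :=
  fine 'E_P[fun w => xi n w ^+ 2].

Definition data_coef (xi : nat -> {RV P >-> R}) (w : Omega) (n : nat) : R :=
  inner (A (U w)) (v n) + xi n w.

(* E(<R(A U + nu; g), u n>^2) *)
Definition reconstruction_coef (xi : nat -> {RV P >-> R}) (g : nat -> R)
    (n : nat) : \bar R :=
  'E_P[fun w => inner (reconstruction u g (data_coef xi w)) (u n) ^+ 2].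

End probability_model.

(* Main.v *)
Require Import Defs.
From mathcomp Require Import all_boot all_order all_algebra.
From mathcomp Require Import sesquilinear.
From mathcomp Require Import all_classical all_reals all_analysis.
From mathcomp Require Import measurable_realfun.
From mathcomp Require Import ring lra.

Import Order.TTheory GRing.Theory Num.Theory.
Import numFieldNormedType.Exports.

Local Open Scope classical_set_scope.
Local Open Scope ring_scope.

(** Write [a_n = g_n (sigma_n <U, u_n> + nu_n)] for the n-th coefficient of the
reconstruction, where [nu_n] is the n-th noise coefficient. Once the series
[\sum_n a_n u_n] is known to converge, its n-th coefficient is [a_n], and
everything reduces to a second moment: [U] and [nu] are independent and [nu_n]
is centered, so the cross term vanishes and
[E a_n^2 = g_n^2 (sigma_n^2 Pi_n + Delta_n)] ([data_second_moment]). For the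
optimal filter this is [sigma_n^2 Pi_n^2 / (sigma_n^2 Pi_n + Delta_n)].

The point that needs care is the convergence. The noise may be white, so
the [nu_n] need not be square summable, and where the series diverges the
reconstruction is a meaningless constant. But the optimal filter
damps the noise enough: [E a_n^2 <= Pi_n], and [\sum_n Pi_n <= E |U|^2] by
Bessel's inequality. Hence [\sum_n a_n^2] has finite expectation and is finite
almost surely, and in a Hilbert space this is equivalent to the convergence of
[\sum_n a_n u_n] ([cvg_orthogonal_series]). The exceptional event is null and
does not affect the expectation ([expectation_sqr_coef_series]).

The bound under the lower bound on [Delta_n] is an elementary inequality
([filter_factor_le]). It gives [sigma_n^2 / (c delta^2)] as a bound for the
ratio, which tends to zero because the singular values of a compact operator
do ([sve_cvg0]). *)

(** * Orthonormal series in a Hilbert space *)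

Section hilbert_geometry.
Set Implicit Arguments.
Unset Strict Implicit.
Context {R : realType} {V : hilbertType R}.
Implicit Types (x y : V) (e : nat -> V) (a : nat -> R).

Lemma innerC x y : inner x y = inner y x.
Proof. by rewrite hermC expr0 mul1r. Qed.

Lemma inner_ge0 x : 0 <= inner x x.
Proof.
have [->|x0] := eqVneq x 0; first by rewrite linear0l.
by apply: ltW; exact: neq0_dnorm_gt0.
Qed.

Lemma inner_normE x : inner x x = `|x| ^+ 2.
Proof. by rewrite norm_inner sqr_sqrtr// inner_ge0. Qed.

Lemma innerZl (b : R) x y : inner (b *: x) y = b * inner x y.
Proof. by rewrite linearZl_LR. Qed.

Lemma innerZr (b : R) x y : inner x (b *: y) = b * inner x y.
Proof. by rewrite innerC innerZl innerC. Qed.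

Lemma sqr_norm_sub_proj x y : `|y| = 1 ->
  `|x - inner x y *: y| ^+ 2 = `|x| ^+ 2 - inner x y ^+ 2.
Proof.
move=> y1; rewrite -!inner_normE linearBl !linearBr /= !innerZl !innerZr.
by rewrite (inner_normE y) y1 (innerC y x); ring.
Qed.

(** The Cauchy-Schwarz inequality against a unit vector. *)
Lemma inner_le_norm x y : `|y| = 1 -> `|inner x y| <= `|x|.
Proof.
move=> y1; rewrite -ler_sqr ?nnegrE// real_normK ?num_real//.
by rewrite -subr_ge0 -sqr_norm_sub_proj// sqr_ge0.
Qed.

Lemma inner_continuous y : `|y| = 1 -> continuous (fun x => inner x y : R).
Proof.
move=> y1 x; apply/cvgrPdist_le => eps eps0.
near=> z; rewrite -linearBl; apply: le_trans (inner_le_norm _ y1) _.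
by near: z; apply: cvgr_dist_le.
Unshelve. all: end_near. Qed.

Definition orthonormal e := forall i j, inner (e i) (e j) = (i == j)%:R.

Lemma orthonormal_norm e i : orthonormal e -> `|e i| = 1.
Proof. by move=> oe; rewrite norm_inner oe eqxx sqrtr1. Qed.

Lemma inner_sum e a m n k : orthonormal e -> (m <= k < n)%N ->
  inner (\sum_(m <= i < n) a i *: e i) (e k) = a k.
Proof.
move=> oe mkn; rewrite linear_sumlz /=.
rewrite (bigD1_seq k) ?mem_index_iota ?iota_uniq//= innerZl oe eqxx mulr1.
by rewrite big1 ?addr0// => i /negbTE ik; rewrite innerZl oe ik mulr0.
Qed.

Lemma sqr_norm_sum e a m n : orthonormal e ->
  `|\sum_(m <= i < n) a i *: e i| ^+ 2 = \sum_(m <= i < n) a i ^+ 2.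
Proof.
move=> oe; rewrite -inner_normE linear_sumr; apply: eq_big_nat => i mi.
by rewrite /= innerZr inner_sum.
Qed.

(** By Pythagoras the blocks of the two series have the same size, up to a
square root, so the Cauchy criteria agree. *)
Lemma cvg_orthogonal_series e a : orthonormal e ->
  cvgn (series (fun i => a i *: e i)) <-> cvgn (series (fun i => a i ^+ 2)).
Proof.
move=> oe.
have cvgE (W : completeNormedModType R) (w : nat -> W) : cvgn (series w) <->
    forall eps, 0 < eps ->
      \forall n \near (\oo, \oo), `|\sum_(n.1 <= k < n.2) w k| < eps.
  by rewrite -cauchy_seriesP; exact: iff_sym (cauchy_cvgP _).
have normE n : `|\sum_(n.1 <= k < n.2) a k ^+ 2| =
    `|\sum_(n.1 <= k < n.2) a k *: e k| ^+ 2.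
  by rewrite sqr_norm_sum// ger0_norm// sumr_ge0// => i _; exact: sqr_ge0.
rewrite !cvgE; split=> H eps eps0.
- have : 0 < Num.sqrt eps by rewrite sqrtr_gt0.
  move=> /H; apply: filterS => n ltn.
  by rewrite normE -[ltRHS]sqr_sqrtr ?ltW// ltr_pXn2r ?nnegrE ?sqrtr_ge0.
- have := H _ (exprn_gt0 2 eps0); apply: filterS => n.
  by rewrite normE ltr_pXn2r ?nnegrE// ltW.
Qed.

Lemma inner_lim_series e a x k : orthonormal e ->
  series (fun i => a i *: e i) @ \oo --> x -> inner x (e k) = a k.
Proof.
move=> oe ax; have e1 := orthonormal_norm k oe.
have : (fun n => inner (series (fun i => a i *: e i) n) (e k) : R) @ \oo -->
    (inner x (e k) : R).
  exact: (cvg_comp _ _ ax (@inner_continuous _ e1 x)).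
move=> /cvg_lim <-//; apply: lim_near_cst => //.
by near=> n; rewrite seriesEnat /= inner_sum//=; near: n; exists k.+1.
Unshelve. all: end_near. Qed.

(** When the series diverges, [limn] is the default point of the space. *)
Lemma inner_limn_series e a k : orthonormal e ->
  inner (limn (series (fun i => a i *: e i))) (e k) =
  if `[< cvgn (series (fun i => a i ^+ 2)) >] then a k else inner point (e k).
Proof.
move=> oe; case: asboolP => [/(cvg_orthogonal_series _ oe)/cvgP cv|ncv].
  exact: (inner_lim_series (x := limn _)).
rewrite dvgP//.
by move=> /(cvg_orthogonal_series _ oe).
Qed.

(** The projection [s] of [x] satisfies [<x, s> = <s, s>], so
[0 <= <x - s, x - s> = <x, x> - <s, s>]. *)
Lemma bessel e x n : orthonormal e ->
  \sum_(0 <= i < n) inner x (e i) ^+ 2 <= `|x| ^+ 2.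
Proof.
move=> oe; pose s := \sum_(0 <= i < n) inner x (e i) *: e i.
have xs : inner x s = inner s s.
  rewrite {2 3}/s linear_sumr [RHS]linear_sumr.
  apply: eq_big_nat => i im.
  by rewrite /= !innerZr inner_sum.
rewrite -(sqr_norm_sum (fun i => inner x (e i)) _ _ oe) -/s -!inner_normE.
rewrite -subr_ge0; have := inner_ge0 (x - s).
by rewrite linearBl !linearBr /= (innerC s x) xs subrr subr0.
Qed.

End hilbert_geometry.

(** * Singular values of a compact operator *)

Section singular_values.
Context {R : realType} {X Y : hilbertType R} (A : {linear X -> Y}).
Context (sigma : nat -> R) (u : nat -> X) (v : nat -> Y).
Hypothesis sve : singular_value_expansion A sigma u v.

Lemma sve_orthonormal : orthonormal u /\ orthonormal v.
Proof. by have [_ _ [ou _] [ov _] _] := sve. Qed.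

Lemma sve_coef x n : inner (A x) (v n) = sigma n * inner x (u n).
Proof.
have [_ _ _ [ov _] /(_ x) Ax] := sve.
exact: (inner_lim_series (a := fun i => sigma i * inner x (u i)) _ ov Ax).
Qed.

(** The singular values decrease to some [s]. If [s > 0], the vectors
[A (u n) = sigma n *: v n] are orthogonal of norm at least [s], hence pairwise
at distance at least [s], and cannot accumulate anywhere in a compact set. *)
Lemma sve_cvg0 : compact_operator A -> sigma @ \oo --> (0 : R).
Proof.
move=> cA; have [sigma0 dsigma _ _ _] := sve; have [ou ov] := sve_orthonormal.
have ds m n : (m <= n)%N -> sigma n <= sigma m by rewrite dsigma.
have cs : cvgn sigma.
  apply: nonincreasing_is_cvgn => //.
  by exists 0 => _ [n _ <-]; exact: ltW.
have s0 : 0 <= limn sigma.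
  by apply: limr_ge => //; apply: nearW => n; exact: ltW.
have [/eqP s00|sn0] := boolP (limn sigma == 0); first by rewrite -s00.
have {sn0}s0 : 0 < limn sigma by rewrite lt_def sn0.
have sle n : limn sigma <= sigma n by exact: nonincreasing_cvgn_ge.
have [K AK [cK _]] : precompact (A @` range u).
  apply: cA; exists 1; split => // r r1 _ [n _ <-].
  by rewrite /= (orthonormal_norm n ou) ltW.
have /cK : ((fun n => A (u n)) @ \oo) K.
  by exists 0%N => // n _; apply: AK; exists (u n) => //; exists n.
move=> [p [_ clp]].
have near_p N : exists2 n, (N <= n)%N & ball p (limn sigma / 2) (A (u n)).
  have [] := clp [set A (u n) | n in [set n | (N <= n)%N]]
                 (ball p (limn sigma / 2)).
  - by exists N => // n Nn; exists n.
  - by apply: nbhsx_ballx; rewrite divr_gt0.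
  - by move=> _ [[n Nn <-] pn]; exists n.
have [n _ pn] := near_p 0%N; have [m nm pm] := near_p n.+1.
have : ball (A (u n)) (limn sigma) (A (u m)).
  by apply: ball_split pm; exact: ball_sym.
rewrite -ball_normE /= ltNge => /negP[]; apply: le_trans (sle n) _.
(* The v n coefficient of A (u n) - A (u m) is already sigma n. *)
have := inner_le_norm (A (u n) - A (u m)) (orthonormal_norm n ov).
rewrite linearBl /= !sve_coef !ou eqxx gtn_eqF// mulr1 mulr0 subr0.
by rewrite ger0_norm// ltW.
Qed.

End singular_values.

(** * Second moments of independent random variables *)

Section second_moments.
Context {d : measure_display} {Omega : measurableType d} {R : realType}.
Context {P : probability Omega R}.
Set Implicit Arguments.
Unset Strict Implicit.

Lemma expectationE (f : Omega -> R) : ('E_P[f] = \int[P]_w (f w)%:E)%E.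
Proof. by rewrite unlock. Qed.

(** Preimages of open intervals are open, and these intervals generate the Borel
sets of the line. *)
Lemma borel_continuous_measurable (V : hilbertType R) (f : V -> R) :
  continuous f -> measurable_fun [set: borel V] (f : borel V -> R).
Proof.
move=> cf; apply: (measurability _ (RGenOpens.measurableE R)).
move=> _ [_ [a [b ->]] <-]; rewrite setTI; apply: sub_sigma_algebra.
by apply: open_comp; [move=> x _; exact: cf|exact: interval_open].
Qed.

(** Independence says that the joint law of [(X, Y)] agrees with the product of
the two laws on rectangles, hence everywhere by uniqueness of the product
measure; Fubini's theorem then separates the variables. *)
Lemma expectationM_independent (X Y : {RV P >-> R}) :
  (forall A B : set R, measurable A -> measurable B ->
    P (X @^-1` A `&` Y @^-1` B) = (P (X @^-1` A) * P (Y @^-1` B))%E) ->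
  P.-integrable setT (EFin \o X) -> P.-integrable setT (EFin \o Y) ->
  P.-integrable setT (EFin \o (fun w => X w * Y w)) ->
  ('E_P[fun w => (X w * Y w)%R] = 'E_P[X] * 'E_P[Y])%E.
Proof.
move=> XY iX iY iXY; rewrite !expectationE.
have mXY : measurable_fun setT (fun w => (X w, Y w)).
  by apply: measurable_fun_pair; exact: measurable_funPT.
pose Z : {RV P >-> (R * R)%type} := mfun_Sub (mem_set mXY).
pose f (z : R * R) : \bar R := (z.1 * z.2)%:E.
have mf : measurable_fun setT f.
  by apply/measurable_EFinP; exact: measurable_funM.
have joint A : measurable A ->
    (distribution P X \x distribution P Y)%E A = distribution P Z A.
  by move=> mA; apply: product_measure_unique => // A1 A2 mA1 mA2; rewrite -XY.
have eqint (h : R * R -> \bar R) :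
    (\int[distribution P Z]_z h z =
     \int[distribution P X \x distribution P Y]_z h z)%E.
  by apply: eq_measure_integral => A mA _; exact: (esym (joint _ mA)).
have iZ : (distribution P Z).-integrable setT f.
  exact: integrable_pushforward.
have iprod : (distribution P X \x distribution P Y)%E.-integrable setT f.
  move/integrableP: iZ => [_ iZ]; apply/integrableP; split => //.
  by rewrite -eqint.
have -> : (\int[P]_w (X w * Y w)%:E = \int[distribution P Z]_z f z)%E.
  by rewrite integral_distribution.
rewrite eqint -integral12_prod_meas1//.
have EX : (\int[distribution P X]_x x%:E = \int[P]_w (X w)%:E)%E.
  by rewrite (@integral_distribution _ _ _ _ _ _ X EFin).
have EY : (\int[distribution P Y]_x x%:E = \int[P]_w (Y w)%:E)%E.
  by rewrite (@integral_distribution _ _ _ _ _ _ Y EFin).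
have iX' : (distribution P X).-integrable setT EFin.
  exact: integrable_pushforward.
have iY' : (distribution P Y).-integrable setT EFin.
  exact: integrable_pushforward.
have -> : fubini_F (distribution P Y) f =
    fun x => (x%:E * \int[P]_w (Y w)%:E)%E.
  apply/funext => x; rewrite /fubini_F /f /=.
  by under eq_integral do rewrite EFinM; rewrite integralZl// EY.
rewrite -EX; have := integrable_fin_num measurableT iY; rewrite /= => /fineK <-.
by rewrite integralZr.
Qed.

Lemma sqr_integrable (Z : {RV P >-> R}) :
  ('E_P[fun w => (Z w ^+ 2)%R] < +oo)%E ->
  P.-integrable setT (EFin \o (fun w => Z w ^+ 2)).
Proof.
rewrite expectationE => Zoo; apply/integrableP; split.
  by apply/measurable_EFinP; exact: measurable_funX.
by under eq_integral do rewrite /= ger0_norm ?sqr_ge0//.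
Qed.

(** [|X Y| <= X^2 + Y^2] pointwise. *)
Lemma sqr_integrableM (X Y : {RV P >-> R}) :
  P.-integrable setT (EFin \o (fun w => X w ^+ 2)) ->
  P.-integrable setT (EFin \o (fun w => Y w ^+ 2)) ->
  P.-integrable setT (EFin \o (fun w => X w * Y w)).
Proof.
move=> iX iY; apply: le_integrable (integrableD measurableT iX iY) => //.
  by apply/measurable_EFinP; exact: measurable_funM.
move=> w _ /=; rewrite lee_fin normrM.
rewrite [leRHS]ger0_norm ?addr_ge0 ?sqr_ge0// -(real_normK (num_real (X w))).
rewrite -(real_normK (num_real (Y w))).
by have := sqr_ge0 (`|X w| - `|Y w|); have := sqr_ge0 (`|X w| + `|Y w|); nra.
Qed.

(** [|X| <= X^2 + 1] pointwise, and constants are integrable. *)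
Lemma sqr_integrable_integrable (X : {RV P >-> R}) :
  P.-integrable setT (EFin \o (fun w => X w ^+ 2)) ->
  P.-integrable setT (EFin \o X).
Proof.
move=> iX.
have i1 := finite_measure_integrable_cst P 1 measurableT.
have := integrableD measurableT iX i1.
apply: le_integrable => //; first by apply/measurable_EFinP.
move=> w _ /=; rewrite lee_fin.
rewrite [leRHS]ger0_norm ?addr_ge0 ?sqr_ge0// -(real_normK (num_real (X w))).
by have := sqr_ge0 (`|X w| - 1); have := normr_ge0 (X w); nra.
Qed.

Lemma second_momentD (X Y : {RV P >-> R}) (s : R) :
  P.-integrable setT (EFin \o (fun w => X w ^+ 2)) ->
  P.-integrable setT (EFin \o (fun w => Y w ^+ 2)) ->
  ('E_P[fun w => (X w * Y w)%R] = 0)%E ->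
  ('E_P[fun w => ((s * X w + Y w) ^+ 2)%R] =
  (s ^+ 2)%:E * 'E_P[fun w => (X w ^+ 2)%R] + 'E_P[fun w => (Y w ^+ 2)%R])%E.
Proof.
move=> iX iY; rewrite !expectationE => XY0.
have iXY := sqr_integrableM iX iY.
have -> : (fun w => ((s * X w + Y w) ^+ 2)%:E) =
  (((fun w => (s ^+ 2)%:E * (X w ^+ 2)%:E) \+ (fun w => (Y w ^+ 2)%:E)) \+
   (fun w => (2 * s)%:E * (X w * Y w)%:E))%E.
  apply/funext => w /=; rewrite -!EFinM -!EFinD; congr (_%:E).
  by ring.
have i1 : P.-integrable setT (fun w => (s ^+ 2)%:E * (X w ^+ 2)%:E)%E.
  exact: integrableZl.
have i2 : P.-integrable setT (fun w => (2 * s)%:E * (X w * Y w)%:E)%E.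
  exact: integrableZl.
rewrite integralD//; last exact: integrableD.
by rewrite integralD// !integralZl// XY0 mule0 adde0.
Qed.

End second_moments.

(** * Orthonormal series with random coefficients *)

Section random_series.
Context {d : measure_display} {Omega : measurableType d} {R : realType}.
Context {P : probability Omega R} {V : hilbertType R}.
Set Implicit Arguments.
Unset Strict Implicit.

Lemma summable_sqr_cvgE (a : nat -> R) :
  cvgn (series (fun i => a i ^+ 2)) <->
  (\sum_(0 <= i <oo) (a i ^+ 2)%:E < +oo)%E.
Proof.
split; last by apply: nnseries_is_cvg => i; exact: sqr_ge0.
move=> ca; have -> : (fun n => \sum_(0 <= i < n) (a i ^+ 2)%:E)%E =
    EFin \o series (fun i => a i ^+ 2).
  by apply/funext => n /=; rewrite seriesEnat sumEFin.
by rewrite EFin_lim// ltry.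
Qed.

(** The sum [S] of the squared coefficients has finite expectation, so it is
finite, and the series converges, almost surely. The convergence event is
measurable because it is the event that [S] is finite, and the limit is a
constant off it; this makes the left-hand integrand measurable, as needed to
discard a null set. *)
Lemma expectation_sqr_coef_series (e : nat -> V) (a : nat -> Omega -> R) n :
  orthonormal e -> (forall i, measurable_fun setT (a i)) ->
  (\sum_(0 <= i <oo) 'E_P[fun w => (a i w ^+ 2)%R] < +oo)%E ->
  ('E_P[fun w => (inner (limn (series (fun i => a i w *: e i))) (e n) ^+ 2)%R] =
   'E_P[fun w => (a n w ^+ 2)%R])%E.
Proof.
move=> oe ma sa; rewrite !expectationE.
pose S w := (\sum_(0 <= i <oo) (a i w ^+ 2)%:E)%E.
have ma2 i : measurable_fun setT (fun w => (a i w ^+ 2)%:E).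
  by apply/measurable_EFinP; exact: measurable_funX.
have a20 i w : (0 <= (a i w ^+ 2)%:E)%E by rewrite lee_fin sqr_ge0.
have mS : measurable_fun setT S by exact: ge0_emeasurable_sum.
have S0 w : (0 <= S w)%E by apply: nneseries_ge0 => i _ _.
have iS : P.-integrable setT S.
  apply/integrableP; split => //.
  under eq_integral do rewrite gee0_abs//.
  rewrite integral_nneseries//.
  by under eq_eseriesr do rewrite -expectationE.
have mC : measurable_fun setT (fun w => (S w < +oo)%E).
  exact: measurable_fun_lte.
have -> : (fun w =>
      (inner (limn (series (fun i => a i w *: e i))) (e n) ^+ 2)%:E) =
    fun w => (if (S w < +oo)%E then a n w ^+ 2 else inner point (e n) ^+ 2)%:E.
  apply/funext => w; rewrite inner_limn_series//.
  have -> : `[< cvgn (series (fun i => a i w ^+ 2)) >] = (S w < +oo)%E.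
    by apply/asboolP/idP => /summable_sqr_cvgE.
  by case: ifP.
apply: ae_eq_integral => //.
  apply/measurable_EFinP; apply: measurable_fun_ifT => //.
  exact: measurable_funX.
have := integrable_ae measurableT iS; apply: filterS => w /(_ I) Sw _.
by rewrite ltey_eq Sw.
Qed.

End random_series.

(** * The optimal spectral reconstruction *)

Section spectral_reconstruction.
Context {R : realType} {X Y : hilbertType R} {A : {linear X -> Y}}.
Context {sigma : nat -> R} {u : nat -> X} {v : nat -> Y}.
Hypothesis sve : singular_value_expansion A sigma u v.
Context {d : measure_display} {Omega : measurableType d}.
Context {P : probability Omega R} {U : {RV P >-> borel X}}.
Hypothesis U_moment : ('E_P[fun w => (`|(U w : X)| ^+ 2)%R] < +oo)%E.

Let ou : orthonormal u := (sve_orthonormal sve).1.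

Lemma measurable_signal n : measurable_fun setT (fun w => inner (U w : X) (u n)).
Proof.
apply: (measurableT_comp (f := fun x : borel X => inner (x : X) (u n))) => //.
apply: borel_continuous_measurable => x.
exact: (@inner_continuous _ _ _ (orthonormal_norm n ou) x).
Qed.

Definition signal n : {RV P >-> R} := mfun_Sub (mem_set (measurable_signal n)).

(** Bessel's inequality, integrated. *)
Lemma sum_signal_moment :
  (\sum_(0 <= n <oo) 'E_P[fun w => (signal n w ^+ 2)%R] < +oo)%E.
Proof.
apply: le_lt_trans U_moment.
under eq_eseriesr do rewrite expectationE.
have m2 n : measurable_fun setT (fun w => (signal n w ^+ 2)%:E).
  by apply/measurable_EFinP; exact: measurable_funX.
have p2 n w : (0 <= (signal n w ^+ 2)%:E)%E by rewrite lee_fin sqr_ge0.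
rewrite -integral_nneseries// expectationE; apply: ge0_le_integral => //.
- by move=> w _; exact: nneseries_ge0.
- exact: ge0_emeasurable_sum.
- apply/measurable_EFinP; apply: measurable_funX.
  apply: (measurableT_comp (f := fun x : borel X => `|x : X|)) => //.
  by apply: borel_continuous_measurable => x; exact: norm_continuous.
- move=> w _; apply: lime_le; first exact: is_cvg_nneseries.
  by apply: nearW => n; rewrite sumEFin lee_fin; exact: bessel.
Qed.

(** The expectation is finite as a term of a nonnegative series with finite sum, so
taking its real part loses nothing. *)
Lemma signal_coefE n :
  (signal_coef u U n)%:E = 'E_P[fun w => (signal n w ^+ 2)%R]%E.
Proof.
rewrite /signal_coef fineK// ge0_fin_numE; last first.
  by apply: expectation_ge0 => w; exact: sqr_ge0.
apply: le_lt_trans sum_signal_moment.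
have E0 k : (0 <= 'E_P[fun w => (signal k w ^+ 2)%R])%E.
  by apply: expectation_ge0 => w; exact: sqr_ge0.
apply: le_trans (nneseries_lim_ge n.+1 _) => //.
by rewrite big_nat_recr//= leeDr// sume_ge0// => i _; exact: E0.
Qed.

Context {xi : nat -> {RV P >-> R}}.
Hypothesis U_xi : independent_of_seq U xi.
Hypothesis xi_mean : forall n, ('E_P[xi n] = 0)%E.
Hypothesis xi_moment : forall n, ('E_P[fun w => (xi n w ^+ 2)%R] < +oo)%E.

Lemma noise_coefE n : (noise_coef xi n)%:E = 'E_P[fun w => (xi n w ^+ 2)%R]%E.
Proof.
rewrite /noise_coef fineK// ge0_fin_numE//.
by apply: expectation_ge0 => w; exact: sqr_ge0.
Qed.

Lemma signal_noise_uncorrelated n :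
  ('E_P[fun w => (signal n w * xi n w)%R] = 0)%E.
Proof.
have iS : P.-integrable setT (EFin \o (fun w => signal n w ^+ 2)).
  by apply: sqr_integrable; rewrite -signal_coefE ltry.
have iN := sqr_integrable (xi_moment n).
rewrite expectationM_independent ?xi_mean ?mule0//.
- move=> B C mB mC; apply: U_xi.
    exists ((fun x : borel X => inner (x : X) (u n)) @^-1` B); last first.
      by rewrite setTI.
    rewrite -[X in measurable X]setTI.
    apply: borel_continuous_measurable => // x.
    exact: (@inner_continuous _ _ _ (orthonormal_norm n ou) x).
  apply: sub_sigma_algebra; exists n => //; exists C => //.
  by rewrite setTI.
- exact: sqr_integrable_integrable.
- exact: sqr_integrable_integrable.
- exact: sqr_integrableM.
Qed.

Lemma data_second_moment (g : nat -> R) n :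
  'E_P[fun w => ((g n * data_coef A v U xi w n) ^+ 2)%R]%E =
  (g n ^+ 2 * (sigma n ^+ 2 * signal_coef u U n + noise_coef xi n))%:E.
Proof.
have iS : P.-integrable setT (EFin \o (fun w => signal n w ^+ 2)).
  by apply: sqr_integrable; rewrite -signal_coefE ltry.
have iN := sqr_integrable (xi_moment n).
have mom := second_momentD (sigma n) iS iN (signal_noise_uncorrelated n).
rewrite -signal_coefE -noise_coefE -EFinM -EFinD in mom.
rewrite EFinM -mom !expectationE -ge0_integralZl ?lee_fin ?sqr_ge0//.
- by apply: eq_integral => w _; rewrite -EFinM exprMn /data_coef (sve_coef sve).
- apply/measurable_EFinP; apply: measurable_funX; apply: measurable_funD => //.
  exact: measurable_funM.
- by move=> w _; rewrite lee_fin sqr_ge0.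
Qed.

Hypothesis nondegenerate : forall n,
  0 < sigma n ^+ 2 * signal_coef u U n + noise_coef xi n.

Lemma signal_coef_ge0 n : 0 <= signal_coef u U n.
Proof. by apply: fine_ge0; apply: expectation_ge0 => w; exact: sqr_ge0. Qed.

Lemma noise_coef_ge0 n : 0 <= noise_coef xi n.
Proof. by apply: fine_ge0; apply: expectation_ge0 => w; exact: sqr_ge0. Qed.

(** Up to the convergence of the series this is [data_second_moment] with one
factor of the denominator cancelled. *)
Lemma reconstruction_coefE n :
  reconstruction_coef A u v U xi
    (optimal_filter sigma (signal_coef u U) (noise_coef xi)) n =
  (sigma n ^+ 2 * signal_coef u U n /
   (sigma n ^+ 2 * signal_coef u U n + noise_coef xi n) * signal_coef u U n)%:E.
Proof.
set g := optimal_filter _ _ _.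
have momE k : g k ^+ 2 * (sigma k ^+ 2 * signal_coef u U k + noise_coef xi k) =
    sigma k ^+ 2 * signal_coef u U k /
    (sigma k ^+ 2 * signal_coef u U k + noise_coef xi k) * signal_coef u U k.
  have := nondegenerate k; rewrite /g /optimal_filter.
  by move=> /lt0r_neq0 nd; field.
rewrite -momE -data_second_moment /reconstruction_coef /reconstruction.
apply: (expectation_sqr_coef_series
  (a := fun i w => g i * data_coef A v U xi w i)) => //.
  move=> i; apply: measurable_funM => //; apply: measurable_funD => //.
  rewrite (_ : (fun w => _) = fun w => sigma i * signal i w); last first.
    by apply/funext => w; rewrite (sve_coef sve).
  exact: measurable_funM.
(* The filter damps each moment below the corresponding moment of the signal. *)
apply: le_lt_trans sum_signal_moment; apply: lee_nneseries => k _.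
  by move=> _; apply: expectation_ge0 => w; exact: sqr_ge0.
rewrite data_second_moment -signal_coefE lee_fin momE ler_piMl ?signal_coef_ge0//.
by rewrite ler_pdivrMr ?nondegenerate// mul1r lerDl noise_coef_ge0.
Qed.

End spectral_reconstruction.

(** * The smoothness estimate *)

(** The factor is increasing in [p / D], which is at most [1 / b]. *)
Lemma filter_factor_le (R : realFieldType) (s b p D : R) :
  0 < s -> 0 < b -> b * p <= D -> 0 < s ^+ 2 * p + D ->
  s ^+ 2 * p / (s ^+ 2 * p + D) <= 1 / (1 + b / s ^+ 2).
Proof.
move=> s0 b0 bp den0; have s2 := exprn_gt0 2 s0.
have -> : 1 / (1 + b / s ^+ 2) = s ^+ 2 / (s ^+ 2 + b).
  by field; rewrite !gt_eqF//= addr_gt0.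
rewrite ler_pdivrMr// [leRHS]mulrAC ler_pdivlMr ?addr_gt0//.
by have := ler_wpM2l (ltW s2) bp; nra.
Qed.

Theorem mainTheorem3 (R : realType) (X Y : hilbertType R)
    (X_infinite : ~ finite_dim [set: X]) (Y_infinite : ~ finite_dim [set: Y])
    (A : {linear X -> Y}) (A_compact : compact_operator A)
    (A_range : ~ finite_dim (range A))
    (sigma : nat -> R) (u : nat -> X) (v : nat -> Y)
    (sve : singular_value_expansion A sigma u v)
    (d : measure_display) (Omega : measurableType d) (P : probability Omega R)
    (U : {RV P >-> borel X})
    (U_moment : ('E_P[fun w => (`|(U w : X)| ^+ 2)%R] < +oo)%E)
    (nu : R -> nat -> {RV P >-> R})
    (nu_indep : forall delta : R, 0 < delta -> independent_of_seq U (nu delta))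
    (nu_mean : forall (delta : R) (n : nat), 0 < delta ->
       ('E_P[nu delta n] = 0)%E)
    (nu_level : forall delta : R, 0 < delta ->
       ereal_sup (range (fun n => 'E_P[fun w => (nu delta n w ^+ 2)%R]%E)) =
       (delta ^+ 2)%:E) :
  let Pi := signal_coef u U in
  let Delta := fun delta : R => noise_coef (nu delta) in
  let g := fun delta : R => optimal_filter sigma Pi (Delta delta) in
  let tPi := fun (delta : R) (n : nat) =>
    reconstruction_coef A u v U (nu delta) (g delta) n in
  forall nondegenerate : (forall (delta : R) (n : nat), 0 < delta ->
    0 < Pi n \/ 0 < Delta delta n),
  (forall (delta : R) (n : nat), 0 < delta ->
     tPi delta n =
     (sigma n ^+ 2 * Pi n / (sigma n ^+ 2 * Pi n + Delta delta n) * Pi n)%:E) /\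
  (forall (c : R) (n0 : nat), 0 < c ->
     (forall (n : nat) (delta : R), (n0 <= n)%N -> 0 < delta ->
        c * delta ^+ 2 * Pi n <= Delta delta n) ->
     (forall (n : nat) (delta : R), (n0 <= n)%N -> 0 < delta ->
        (tPi delta n <= (1 / (1 + c * delta ^+ 2 / sigma n ^+ 2) * Pi n)%:E)%E) /\
     (forall delta : R, 0 < delta ->
        let ratio := fun n => fine (tPi delta n) / Pi n in
        let F := within [set n | 0 < Pi n] \oo in
        (ratio @ F --> (0 : R)) /\
        (ratio =O_F (fun n => sigma n ^+ 2)))).
Proof.
move=> Pi Delta g tPi nondegenerate.
have sigma0 n : 0 < sigma n by have [/(_ n)] := sve.
have Pi0 n : 0 <= Pi n by exact: signal_coef_ge0.
have Delta0 delta n : 0 <= Delta delta n by exact: noise_coef_ge0.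
have den0 delta n : 0 < delta -> 0 < sigma n ^+ 2 * Pi n + Delta delta n.
  move=> delta0; have s2 := exprn_gt0 2 (sigma0 n).
  case: (nondegenerate delta n delta0) => [Pin|Deltan].
    by rewrite ltr_pwDl// mulr_gt0.
  by rewrite ltr_wpDl// mulr_ge0// ltW.
have nu_moment delta n : 0 < delta ->
    ('E_P[fun w => (nu delta n w ^+ 2)%R] < +oo)%E.
  move=> delta0; apply: (@le_lt_trans _ _ (delta ^+ 2)%:E); last exact: ltry.
  by rewrite -(nu_level delta delta0); apply: ereal_sup_ubound; exists n.
have tPiE delta n : 0 < delta -> tPi delta n =
    (sigma n ^+ 2 * Pi n / (sigma n ^+ 2 * Pi n + Delta delta n) * Pi n)%:E.
  move=> delta0; apply: (reconstruction_coefE sve U_moment (nu_indep delta delta0)).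
  - by move=> k; exact: nu_mean.
  - by move=> k; exact: nu_moment.
  - by move=> k; exact: den0.
split=> // c n0 c0 Hc; split=> [n delta n0n delta0|delta delta0].
  rewrite tPiE// lee_fin ler_wpM2r//.
  apply: filter_factor_le (Hc _ _ n0n delta0) (den0 _ _ delta0) => //.
  by rewrite mulr_gt0// exprn_gt0.
move=> ratio F.
have ratio_le n : (n0 <= n)%N -> 0 < Pi n ->
    `|ratio n| <= (c * delta ^+ 2)^-1 * sigma n ^+ 2.
  move=> n0n Pin; rewrite /ratio tPiE//= mulfK ?gt_eqF//.
  have cd0 : 0 < c * delta ^+ 2 by rewrite mulr_gt0// exprn_gt0.
  rewrite ger0_norm; last first.
    by rewrite divr_ge0 ?mulr_ge0 ?sqr_ge0// ltW// den0.
  apply: le_trans (filter_factor_le (sigma0 n) cd0 (Hc _ _ n0n delta0)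
    (den0 _ _ delta0)) _.
  have s2 := exprn_gt0 2 (sigma0 n).
  have -> : (c * delta ^+ 2)^-1 * sigma n ^+ 2 =
      (c * delta ^+ 2 / sigma n ^+ 2)^-1.
    by rewrite invf_div mulrC.
  rewrite mul1r lef_pV2 ?posrE ?lerDr//.
    by rewrite ltr_pwDl// divr_ge0// ltW.
  exact: divr_gt0.
have F_le : \forall n \near F, `|ratio n| <= (c * delta ^+ 2)^-1 * sigma n ^+ 2.
  by exists n0 => // n n0n Pin; exact: ratio_le.
have s_cvg0 := sve_cvg0 sve A_compact.
split.
  apply: norm_cvg0.
  apply: (squeeze_cvgr (f := fun=> 0)
    (h := fun n => (c * delta ^+ 2)^-1 * sigma n ^+ 2)).
  - by apply: filterS F_le => n ->; rewrite normr_ge0.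
  - exact: cvg_cst.
  - apply: cvg_within_filter.
    have s2_cvg0 : sigma n ^+ 2 @[n --> \oo] --> (0 : R).
      have := cvgM (F := \oo) s_cvg0 s_cvg0; rewrite mulr0 => lim0.
      exact: lim0.
    have := cvgMl_tmp (a := (c * delta ^+ 2)^-1) s2_cvg0; rewrite mulr0 => lim0.
    exact: lim0.
apply/eqO_exP; exists (c * delta ^+ 2)^-1.
  by rewrite invr_gt0 mulr_gt0// exprn_gt0.
apply: filterS F_le => n /le_trans; apply; rewrite ler_wpM2l ?ler_norm//.
by rewrite invr_ge0 ltW// mulr_gt0// exprn_gt0.
Qed.
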